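(* Let $X,Y,Z,W$ be locally convex Hausdorff topological vector spaces, $K\subset Y$ a proper closed convex cone with $\operatorname{int}K\ne\emptyset$, $P\subset W$ and $S\subset Z$ nonempty convex cones, $F\colon X\to Y^\infty$, $\kappa\colon W\to Y^\infty$, $H\colon X\to W^\infty$, $G\colon X\to Z^\infty$ proper mappings, $C\subset X$ nonempty, $A=C\cap G^{-1}(-S)$, and assume $A\cap\operatorname{dom}F\cap H^{-1}(\operatorname{dom}\kappa)\neq\emptyset$. Put $$\mathcal M^1=\bigcup_{T_1\in\operatorname{dom}\kappa^*,\; T_2\in\mathcal L_+^w(S,K)}\Psi\big(\mathfrak E\mathrm{pi}(F+T_1\circ H+T_2\circ G+I_C)^*\boxplus\{(0_{\mathcal L},\kappa^*(T_1)\uplus I_{-S}^*(T_2))\}\big),$$ $$\mathcal M^1_+=\bigcup_{T_1\in\operatorname{dom}\kappa^*\cap\mathcal L_+(P,K),\; T_2\in\mathcal L_+(S,K)}\Psi\big(\mathfrak E\mathrm{pi}(F+T_1\circ H+T_2\circ G+I_C)^*\boxplus\{(0_{\mathcal L},\kappa^*(T_1))\}\big).$$ For $(L,y)\in\mathcal L(X,Y)\times Y$ consider the assertions: $(\alpha')$ if $x\in C$ and $G(x)\in-S$, then $F(x)+(\kappa\circ H)(x)-L(x)+y\notin-\operatorname{int}K$; $(\beta')$ there exist $T_1\in\operatorname{dom}\kappa^*$ and $T_2\in\mathcal L_+^w(S,K)$ such that $F(x)+(T_1\circ H)(x)+(T_2\circ G)(x)-L(x)+y\notin\kappa^*(T_1)+T_2(-S)-\operatorname{int}K$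 for all $x\in C$; $(\gamma')$ there exist $T_1\in\operatorname{dom}\kappa^*\cap\mathcal L_+(P,K)$ and $T_2\in\mathcal L_+(S,K)$ such that $F(x)+(T_1\circ H)(x)+(T_2\circ G)(x)-L(x)+y\notin\kappa^*(T_1)-\operatorname{int}K$ for all $x\in C$. Then: (1) $\operatorname{epi}(F+\kappa\circ H+I_A)^*=\mathcal M^1$ if and only if $(\alpha')\Leftrightarrow(\beta')$ for all $(L,y)\in\mathcal L(X,Y)\times Y$; (2) $\operatorname{epi}(F+\kappa\circ H+I_A)^*=\mathcal M^1_+$ if and only if $(\alpha')\Leftrightarrow(\gamma')$ for all $(L,y)\in\mathcal L(X,Y)\times Y$.
   Context: Ordering: $K$ proper means $K\neq Y$. $y_1<_K y_2$ iff $y_1-y_2\in-\operatorname{int}K$. $Y^\infty=Y\cup\{+\infty_Y\}$, $Y^\bullet=Y\cup\{\pm\infty_Y\}$, with $-\infty_Y<_Ky<_K+\infty_Y$ for $y\in Y$, $-\infty_Y<_K+\infty_Y$, $-(\pm\infty_Y)=\mp\infty_Y$, $y+(+\infty_Y)=+\infty_Y$ for $y\in Y^\infty$, $M+\{+\infty_Y\}=\{+\infty_Y\}$ for $M\subset Y$; similarly $W^\infty=W\cup\{+\infty_W\}$, $Z^\infty=Z\cup\{+\infty_Z\}$. For $M\subset Y^\bullet$: $\operatorname{WSup}M$ is the set of $\bar v\in Y^\bullet$ such that $\bar v\not<_Kv$ for all $v\in M$ and for every $\tilde v\in Y^\bullet$ with $\tilde v<_K\bar v$ there is $v\in M$ with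 $\tilde v<_Kv$. A mapping into $Y^\infty$ (or $W^\infty$, $Z^\infty$) is proper if its domain (set of points where it is not $+\infty$) is nonempty. $\kappa(+\infty_W)=+\infty_Y$. For $T\in\mathcal L(Z,Y)$ (continuous linear maps), $(T\circ G)(x)=T(G(x))$ if $G(x)\in Z$ and $+\infty_Y$ otherwise; likewise $T\circ H$. $I_D(x)=0_Y$ if $x\in D$, $+\infty_Y$ otherwise. $0_{\mathcal L}$ is the zero of $\mathcal L(X,Y)$. $\mathcal L_+(S,K)=\{T\in\mathcal L(Z,Y):T(S)\subset K\}$, $\mathcal L_+^w(S,K)=\{T\in\mathcal L(Z,Y):T(S)\cap(-\operatorname{int}K)=\emptyset\}$, and $\mathcal L_+(P,K)$ is defined analogously. Conjugates: for $E\colon X\to Y^\infty$, $E^*(L)=\operatorname{WSup}\{L(x)-E(x):x\in X\}$, $\operatorname{dom}E^*=\{L:E^*(L)\neq\{+\infty_Y\}\}$, $\operatorname{epi}E^*=\{(L,y)\in\mathcal L(X,Y)\times Y:y\in E^*(L)+K\}$; likewise for mappings on $W$, $Z$ ($\kappa^*$, $I_{-S}^*$). Set order: for nonempty $M,N\subset Y^\bullet$, $M\preccurlyeq_KN$ iff $v\not<_Ku$ for all $u\in M$, $v\in N$. $\mathcal P_p(Y)$ is the collection of $U\subset Y$ such that $Y$ is the disjoint union of $U-\operatorname{int}K$, $U$, $U+\operatorname{int}K$; $\mathcal P_p(Y)^\infty=\mathcal P_p(Y)\cup\{\{+\infty_Y\}\}$. For $U,V\in\mathcal P_p(Y)^\infty$,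 $U\uplus V=\operatorname{WSup}(U+V)$. Extended epigraph: $\mathfrak E\mathrm{pi}E^*=\{(L,U)\in\mathcal L(X,Y)\times\mathcal P_p(Y):L\in\operatorname{dom}E^*,\ E^*(L)\preccurlyeq_KU\}$. $\mathscr M\boxplus\mathscr N=\{(L_1+L_2,U_1\uplus U_2):(L_1,U_1)\in\mathscr M,(L_2,U_2)\in\mathscr N\}$. $\Psi(L,U)=\{L\}\times U$ for $U\in\mathcal P_p(Y)$, and $\Psi(\mathscr M)=\bigcup_{(L,U)\in\mathscr M}\Psi(L,U)$; pairs $(L,\{+\infty_Y\})$ that may arise from $\uplus$ contribute the empty set to $\Psi$. *)

(* Defs.v *)
From HB Require Import structures.
From mathcomp Require Import all_boot all_order all_algebra.
From mathcomp Require Import all_classical all_reals all_analysis.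

Set Implicit Arguments.
Unset Strict Implicit.
Unset Printing Implicit Defensive.

Import Order.TTheory GRing.Theory Num.Theory.
Import numFieldNormedType.Exports.

Local Open Scope classical_set_scope.
Local Open Scope ring_scope.

(* [\bar V], the library's two-point extension of an arbitrary type, plays the *)
(* role of V^•. A mapping into V^∞ is a mapping into [\bar V] that never takes *)
(* the value -oo (hypothesis [noninfty] below). On such values [adde] is the   *)
(* addition of the paper: y + (+oo) = +oo; no sum (+oo) + (-oo) ever occurs.   *)

Section ContinuousLinear.
Variables (R : realType) (X Y : tvsType R).

Definition contlin : {pred X -> Y} := fun f => `[< linear f /\ continuous f >].

Fact contlin_zmod_closed : zmod_closed contlin.
Proof.
split=> [|f g /asboolP[lf cf] /asboolP[lg cg]]; apply/asboolP.
  split; first by move=> a u v; rewrite /GRing.zero /= scaler0 addr0.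
  by move=> x; exact: cst_continuous.
split=> [a u v|x].
  by rewrite !fctE lf lg scalerBr opprD !addrA; congr (_ - _); rewrite addrAC.
apply: (@continuous_comp _ _ _ (fun x => (f x, g x)) (fun z : Y * Y => z.1 - z.2)).
  by apply: cvg_pair; [exact: cf|exact: cg].
exact: sub_continuous.
Qed.

HB.instance Definition _ :=
  GRing.isZmodClosed.Build (X -> Y) contlin contlin_zmod_closed.

(* The space of continuous linear maps, an additive group under pointwise      *)
(* addition.                                                                   *)
Record clin := CLin { clin_fun :> X -> Y ; clinP : clin_fun \in contlin }.

HB.instance Definition _ := [isSub of clin for clin_fun].
HB.instance Definition _ := [Choice of clin by <:].
HB.instance Definition _ := [SubChoice_isSubZmodule of clin by <:].

End ContinuousLinear.

Section Mappings.
Variables (R : realType).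

(* Closure under positive scalars only: 0 need not belong to a cone.           *)
Definition convex_cone (V : tvsType R) (S : set V) : Prop :=
  convex_set (S : set (convex_lmodType V)) /\
  forall (t : R) (v : V), 0 < t -> S v -> S (t *: v).

Definition oppset (V : zmodType) (S : set V) : set V := [set - v | v in S].

Definition noninfty (T V : Type) (E : T -> \bar V) : Prop :=
  forall x, E x <> -oo%E.

Definition dom (T V : Type) (E : T -> \bar V) : set T :=
  [set x | E x <> +oo%E].

Definition proper_map (T V : Type) (E : T -> \bar V) : Prop :=
  noninfty E /\ dom E !=set0.

(* Composition after a mapping into V^∞, extended by (+oo) |-> +oo.            *)
Definition ecomp (T V Y : Type) (f : V -> \bar Y) (E : T -> \bar V) :
    T -> \bar Y :=
  fun x => if E x is v%:E%E then f v else +oo%E.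

Definition lcomp (T : Type) (V Y : tvsType R) (L : clin V Y) (E : T -> \bar V) :
    T -> \bar Y :=
  ecomp (fun v => (L v)%:E%E) E.

Definition indic_map (T : Type) (Y : zmodType) (D : set T) : T -> \bar Y :=
  fun x => if x \in D then 0%:E%E else +oo%E.

Definition feasible (T : Type) (V : zmodType) (C : set T) (G : T -> \bar V)
    (S : set V) : set T :=
  C `&` G @^-1` (EFin @` oppset S).

End Mappings.

Section ConeOrder.
Variables (R : realType) (Y : tvsType R) (K : set Y).

Definition ltK (u v : \bar Y) : Prop :=
  match u, v with
  | a%:E%E, b%:E%E => oppset (interior K) (a - b)
  | -oo%E, _%:E%E | -oo%E, +oo%E | _%:E%E, +oo%E => True
  | _, _ => False
  end.

Definition WSup (M : set (\bar Y)) : set (\bar Y) :=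
  [set v | (forall u, M u -> ~ ltK v u) /\
           (forall w, ltK w v -> exists2 u, M u & ltK w u)].

Definition eaddset (M N : set (\bar Y)) : set (\bar Y) :=
  [set (u + v)%E | u in M & v in N].

(* Only used when both sets are nonempty. *)
Definition preceqK (M N : set (\bar Y)) : Prop :=
  forall u v, M u -> N v -> ~ ltK v u.

Definition Pp : set (set Y) :=
  [set U | let Um := [set u - k | u in U & k in interior K] in
           let Up := [set u + k | u in U & k in interior K] in
           [/\ Um `|` U `|` Up = setT,
               Um `&` U = set0, U `&` Up = set0 & Um `&` Up = set0]].

(* Elements of P_p(Y)^∞ are handled as subsets of [\bar Y].                    *)
Definition uplus (U V : set (\bar Y)) : set (\bar Y) := WSup (eaddset U V).

Section Conjugate.
Variable X : tvsType R.

Definition conj_map (E : X -> \bar Y) (L : clin X Y) : set (\bar Y) :=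
  WSup [set ((L x)%:E - E x)%E | x in [set: X]].

Definition conj_dom (E : X -> \bar Y) : set (clin X Y) :=
  [set L | conj_map E L <> [set +oo%E]].

Definition conj_epi (E : X -> \bar Y) : set (clin X Y * Y) :=
  [set p | eaddset (conj_map E p.1) (EFin @` K) p.2%:E%E].

Definition conj_Epi (E : X -> \bar Y) : set (clin X Y * set (\bar Y)) :=
  [set p | [/\ conj_dom E p.1, [set EFin @` U | U in Pp] p.2
             & preceqK (conj_map E p.1) p.2]].

Definition boxplus (M N : set (clin X Y * set (\bar Y))) :
    set (clin X Y * set (\bar Y)) :=
  [set (p.1 + q.1, uplus p.2 q.2) | p in M & q in N].

(* Empty when [p.2 = [set +oo]].                                               *)
Definition Psi1 (p : clin X Y * set (\bar Y)) : set (clin X Y * Y) :=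
  [set p.1] `*` (EFin @^-1` p.2).

Definition Psi (M : set (clin X Y * set (\bar Y))) : set (clin X Y * Y) :=
  \bigcup_(p in M) Psi1 p.

End Conjugate.

Definition Lplus (Z : tvsType R) (S : set Z) : set (clin Z Y) :=
  [set T : clin Z Y | T @` S `<=` K].

Definition Lwplus (Z : tvsType R) (S : set Z) : set (clin Z Y) :=
  [set T : clin Z Y | T @` S `&` oppset (interior K) = set0].

End ConeOrder.

(* Main.v *)
Require Import Defs.
From HB Require Import structures.
From mathcomp Require Import all_boot all_order all_algebra.
From mathcomp Require Import all_classical all_reals all_analysis.

Set Implicit Arguments.
Unset Strict Implicit.
Unset Printing Implicit Defensive.

Import Order.TTheory GRing.Theory Num.Theory.
Import numFieldNormedType.Exports.

Local Open Scope classical_set_scope.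
Local Open Scope ring_scope.

(* Say that y is below a set N if y <_K v for some v in N. A weak supremum has
   the same lower points as the set it comes from: from a point not below N,
   moving along -e with e in int K reaches WSup N. Hence y lies in WSup N + K
   iff y is not below N, which turns the epigraph of the conjugate of
   F + kappa o H + I_A into (alpha'). Likewise, with M = {L x - E x} and V a
   weak supremum, some U in P_p(Y) with WSup M <=_K U has y in WSup (U + V) iff
   y is not below M + V; replacing V by a generating set then gives (beta') and
   (gamma'). So in both parts the equality of sets is, pointwise, the
   equivalence of the assertions. *)

(** * Interior points of a closed convex cone *)

Section ConvexCone.
Variables (R : realType) (Y : tvsType R) (K : set Y).
Hypotheses (Kclosed : closed K) (Kcone : convex_cone K)
  (Kint : interior K !=set0).
Implicit Types a b e k y : Y.

(** The sum is twice the midpoint: convexity gives the midpoint, the cone property the factor 2. *)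
Lemma cone_add a b : K a -> K b -> K (a + b).
Proof.
case: Kcone => Kconv Kscale Ka Kb.
have h0 : 0 <= 2^-1 :> R by rewrite invr_ge0 ler0n.
have h1 : 2^-1 <= 1 :> R by rewrite invf_le1 ?ler1n ?ltr0n.
have /set_mem Kab := Kconv a b (Itv01 h0 h1) (mem_set Ka) (mem_set Kb).
have /Kscale/(_ Kab) : 0 < 2 :> R by rewrite ltr0n.
rewrite /conv/= [X in K X -> _](_ : _ = a + b)//.
have -> : unstable.onem 2^-1 = 2^-1 :> R.
  rewrite /unstable.onem; apply/eqP; rewrite subr_eq -mulr2n -[_ *+ 2]mulr_natl.
  by rewrite mulfV ?pnatr_eq0.
by rewrite -scalerDr scalerA mulfV ?pnatr_eq0// scale1r.
Qed.

Lemma line_continuous a b : continuous (fun t : R^o => a + t *: b).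
Proof.
move=> t; apply: (@continuous_comp _ _ _ (fun t : R^o => (a, t *: b))
  (fun z : Y * Y => z.1 + z.2)); last exact: add_continuous.
apply: cvg_pair; first exact: cvg_cst.
apply: (@continuous_comp _ _ _ (fun t : R^o => (t, b))
  (fun z : R^o * Y => z.1 *: z.2)); last exact: scale_continuous.
apply: (@cvg_pair _ _ _ _ (nbhs (t : R^o)) (nbhs b)).
  exact: cvg_id.
exact: cvg_cst.
Qed.

Lemma homothety_continuous a (t : R) : continuous (fun x : Y => a + t *: x).
Proof.
move=> x; apply: (@continuous_comp _ _ _ (fun x : Y => (a, t *: x))
  (fun z : Y * Y => z.1 + z.2)); last exact: add_continuous.
apply: cvg_pair; first exact: cvg_cst.
apply: (@continuous_comp _ _ _ (fun x : Y => ((t : R^o), x))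
  (fun z : R^o * Y => z.1 *: z.2)); last exact: scale_continuous.
apply: (@cvg_pair _ _ _ _ (nbhs (t : R^o)) (nbhs x)).
  exact: cvg_cst.
exact: cvg_id.
Qed.

Lemma interior_line a b : interior K a ->
  exists2 t : R, 0 < t & interior K (a + t *: b).
Proof.
move=> Ka; have := @line_continuous a b 0 (interior K); rewrite scale0r addr0.
move=> /(_ (open_nbhs_nbhs (conj (@open_interior _ K) Ka))).
move=> /nbhs_ballP[d /= d0 dK].
exists (d / 2); first by rewrite divr_gt0.
apply: dK; rewrite /ball/= sub0r normrN gtr0_norm ?divr_gt0//.
by rewrite gtr_pMr// invf_lt1 ?ltr1n.
Qed.

(** [x |-> t^-1 *: x] is continuous and sends [t *: a] to [a], so it pulls [K] back to a
    neighbourhood of [t *: a], which [t *: K <= K] places inside [K]. *)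
Lemma interior_scale (t : R) a : 0 < t -> interior K a -> interior K (t *: a).
Proof.
move=> t0 Ka; have := @homothety_continuous 0 t^-1 (t *: a) K.
rewrite scalerA mulVf ?gt_eqF// scale1r add0r => /(_ Ka) nK.
rewrite /interior; near=> x; have /= : K (0 + t^-1 *: x) by near: x.
rewrite add0r => /(Kcone.2 _ _ t0).
by rewrite scalerA mulfV ?gt_eqF// scale1r.
Unshelve. all: by end_near. Qed.

Lemma interior_addl k a : K k -> interior K a -> interior K (k + a).
Proof.
move=> Kk Ka; have := @homothety_continuous (- k) 1 (k + a) K.
rewrite scale1r addKr => /(_ Ka) nK.
rewrite /interior; near=> x; have : K (- k + 1 *: x) by near: x.
by rewrite scale1r => /(cone_add Kk); rewrite addNKr.
Unshelve. all: by end_near. Qed.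

Lemma interior_add a b : interior K a -> interior K b -> interior K (a + b).
Proof. by move=> /interior_subset; exact: interior_addl. Qed.

(** [e + t *: y] stays interior for some [t > 0]; dividing by [t] gives the claim. *)
Lemma interior_absorbing e y : interior K e ->
  exists2 t : R, 0 < t & interior K (y + t *: e).
Proof.
move=> /(@interior_line _ y)[t t0 Kt]; exists t^-1; first by rewrite invr_gt0.
have := interior_scale (_ : 0 < t^-1) Kt; rewrite invr_gt0 => /(_ t0).
by rewrite scalerDr scalerA mulVf ?gt_eqF// scale1r addrC.
Qed.

(** A cone here is closed under positive scalars only, so 0 is reached as a limit of points [t *: e]
    with [t > 0], by closedness. *)
Lemma cone0 e : K e -> K 0.
Proof.
move=> Ke; apply: Kclosed => U U0.
have := @line_continuous 0 e 0 U; rewrite scale0r addr0 => /(_ U0).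
move=> /nbhs_ballP[d /= d0 dK].
exists ((d / 2) *: e); split; first by apply: Kcone.2 => //; rewrite divr_gt0.
rewrite -[_ *: _]add0r; apply: dK.
rewrite /ball/= sub0r normrN gtr0_norm ?divr_gt0//.
by rewrite gtr_pMr// invf_lt1 ?ltr1n.
Qed.


(** * The strict order on the extended space *)

Local Notation lt := (ltK K).

Lemma ltK_fin a b : lt a%:E b%:E <-> interior K (b - a).
Proof.
split; first by case=> k Kk ka; rewrite -opprB -ka opprK.
by move=> Kab; exists (b - a) => //; rewrite opprB.
Qed.

Lemma ltK_subr_addr a b c : lt (a - c)%:E b%:E <-> lt a%:E (b + c)%:E.
Proof. by rewrite !ltK_fin opprB addrA. Qed.

Lemma ltK_subCl a b c : lt (a - b)%:E c%:E <-> lt (a - c)%:E b%:E.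
Proof. by rewrite !ltK_subr_addr addrC. Qed.

Lemma ltK_addr a k : interior K k -> lt a%:E (a + k)%:E.
Proof. by move=> Kk; apply/ltK_fin; rewrite addrC addKr. Qed.

Lemma ltK_trans (u v w : \bar Y) : lt u v -> lt v w -> lt u w.
Proof.
case: u v w => [a||] [b||] [c||] //; rewrite !ltK_fin => Kab Kbc.
by rewrite -(subrK b c) -addrA; exact: interior_add.
Qed.

(** Openness of the strict order: every strict inequality leaves some slack along [e]. The slack
    lets a point of a weak supremum be traded for a point of the generating set. *)
Lemma ltK_line a e (v : \bar Y) : lt a%:E v ->
  exists2 t : R, 0 < t & lt (a + t *: e)%:E v.
Proof.
case: v => [b||] //; last by exists 1.
move=> /ltK_fin/(@interior_line _ (- e))[t t0 Kt]; exists t => //.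
by apply/ltK_fin; rewrite opprD addrA -scalerN.
Qed.

Lemma ltK_absorbing e a b : interior K e ->
  exists2 t : R, 0 < t & lt a%:E (b + t *: e)%:E.
Proof.
move=> /(interior_absorbing (b - a))[t t0 Kt]; exists t => //.
by apply/ltK_fin; rewrite addrAC.
Qed.

Lemma ltK_pinftyl (v : \bar Y) : ~ lt +oo%E v.
Proof. by case: v => [?||] []. Qed.

(** * Lower points and weak suprema *)

Definition below (N : set (\bar Y)) (u : \bar Y) : Prop :=
  exists2 v, N v & lt u v.

(** The value [-oo] is allowed: [L x - E x] takes it wherever [E x] is [+oo]. *)
Definition proper_set (N : set (\bar Y)) : Prop :=
  ~ N +oo%E /\ exists a, N a%:E.

Implicit Types M N V : set (\bar Y).

Lemma WSup_notbelow N u : WSup K N u -> ~ below N u.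
Proof. by move=> [uN _] [v /uN]. Qed.

Lemma WSup_Nninfty N : proper_set N -> ~ WSup K N -oo%E.
Proof. by move=> [_ [a Na]] /WSup_notbelow; apply; exists a%:E. Qed.

(* The point is y - t e for the supremum t of the s such that y - s e is not  *)
(* below N.                                                                   *)
Lemma WSup_line N e y : interior K e -> proper_set N -> ~ below N y%:E ->
  exists2 t : R, 0 <= t & WSup K N (y - t *: e)%:E.
Proof.
move=> Ke [Noo [a Na]] Ny.
have ltt (s t : R) : s < t -> lt (y - t *: e)%:E (y - s *: e)%:E.
  move=> st; apply/ltK_fin; rewrite opprB addrC addrA subrK -scalerBl.
  by apply: interior_scale; rewrite ?subr_gt0.
pose B : set R := [set t | 0 <= t /\ ~ below N (y - t *: e)%:E].
have B0 : B 0 by split; rewrite // scale0r subr0.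
have [T T0 yT] := ltK_absorbing y a Ke.
(* Past [T] the point drops under [a], an element of [N]. *)
have BT : ubound B T.
  move=> t [t0 Nt]; rewrite leNgt; apply/negP => Tt; apply: Nt.
  exists a%:E => //.
  by apply: ltK_trans (ltt _ _ Tt) _; apply/ltK_subr_addr.
have supB : has_sup B by split; [exists 0|exists T].
have sup0 : 0 <= sup B by exact: sup_upper_bound.
exists (sup B) => //; split.
  (* With slack [t], some [s] in [B] exceeds [sup B - t], and [y - s e] would already be below
     [N]. *)
  move=> v Nv /(@ltK_line _ e)[t t0].
  rewrite addrAC -addrA -opprB -scalerBl => ltv.
  have [s [s0 Ns] ts] := sup_adherent t0 supB.
  by apply: Ns; exists v => //; apply: ltK_trans (ltt _ _ ts) ltv.
move=> [w||] //; last by move=> _; exists a%:E.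
(* With slack [t], [w] lies under [y - (sup B + t) e], which is below [N] because [sup B + t] is not
   in [B]. *)
move=> /(@ltK_line _ e)[t t0].
rewrite -[X in w + X]opprK ltK_subr_addr -addrA -opprD -scalerDl => wt.
have [] : below N (y - (sup B + t) *: e)%:E.
  apply: contrapT => Nt; have : B (sup B + t).
    by split=> //; rewrite addr_ge0// ltW.
  by move/(sup_upper_bound supB); rewrite gerDl leNgt t0.
by move=> v Nv tv; exists v => //; exact: ltK_trans tv.
Qed.

(** Left to right is part of the definition of [WSup]. Conversely, if every finite point is below
    [N], then [+oo] is in the weak supremum. Otherwise climb from [y] along [e] past a point not
    below [N], then descend to [WSup K N]; the descent stops above [y]. *)
Lemma below_WSup N y : proper_set N -> below (WSup K N) y%:E <-> below N y%:E.
Proof.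
move=> pN; split=> [[v [_ /[apply]]]//|[n Nn yn]].
have [[y0 Ny0]|Nall] := pselect (exists y0, ~ below N y0%:E); last first.
  exists +oo%E => //; split=> [v _|w]; first exact: ltK_pinftyl.
  have [a Na] := pN.2.
  case: w => [w _|/ltK_pinftyl//|_]; last by exists a%:E.
  by apply: contrapT => Nw; apply: Nall; exists w.
have [e Ke] := Kint.
have [T T0 yT] := ltK_absorbing y0 y Ke.
have [|t t0 Wt] := WSup_line Ke pN (_ : ~ below N (y + T *: e)%:E).
  by move=> [v Nv Tv]; apply: Ny0; exists v => //; exact: ltK_trans yT Tv.
exists (y + T *: e - t *: e)%:E => //.
(* If [T <= t], the point reached is [y] or strictly under it, hence still under [n], contrary to
   its lying in the weak supremum. *)
rewrite -addrA -scalerBl; have [tT|Tt] := ltP t T.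
  by apply/ltK_addr/interior_scale => //; rewrite subr_gt0.
exfalso; apply: (WSup_notbelow Wt); exists n => //.
move: Tt; rewrite le_eqVlt => /predU1P[->|Tt].
  by rewrite -addrA subrr addr0.
apply: ltK_trans yn; rewrite -addrA -scalerBl -opprB scaleNr.
by apply/ltK_subr_addr/ltK_addr/interior_scale; rewrite ?subr_gt0.
Qed.

Lemma WSup_pinfty N : proper_set N -> (forall y, below N y%:E) ->
  WSup K N = [set +oo%E].
Proof.
move=> pN Nall; apply/seteqP; split=> [[y||] Wy //|_ ->].
- by have := WSup_notbelow Wy.
- by have := WSup_Nninfty pN.
- have [v Wv _] := (below_WSup 0 pN).2 (Nall 0).
  have [a Na] := pN.2.
  split=> [u _|]; first exact: ltK_pinftyl.
  by move=> [w _|/ltK_pinftyl//|_]; [exact: Nall|exists a%:E].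
Qed.

Lemma Pp_nonempty (U : set Y) : Pp K U -> U !=set0.
Proof.
move=> [UT _ _ _]; have : setT (0 : Y) by [].
by rewrite -UT => -[[[u Uu]|U0]|[u Uu]]; [exists u|exists 0|exists u].
Qed.

(** A finite point that is not below [N] keeps [+oo] out. Points below [N] then lie in [U - int K]
    by [below_WSup], the others in [U] or [U + int K] by [WSup_line]. The three pieces are disjoint
    because no two points of a weak supremum are strictly comparable. *)
Lemma WSup_Pp N : proper_set N -> WSup K N <> [set +oo%E] ->
  exists2 U, Pp K U & WSup K N = EFin @` U.
Proof.
move=> pN Noo; have [y0 Ny0] : exists y0, ~ below N y0%:E.
  apply: contrapT => Nall; apply/Noo/WSup_pinfty => // y.
  by apply: contrapT => Ny; apply: Nall; exists y.
have Wfin v : WSup K N v -> exists2 u, WSup K N u%:E & v = u%:E.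
  case: v => [u Wu||]; first by exists u.
    move=> [_ /(_ y0%:E)[]// v Nv y0v].
    by exfalso; apply: Ny0; exists v.
  by move/WSup_Nninfty => /(_ pN).
exists (EFin @^-1` WSup K N); last first.
  apply/seteqP; split=> [v /Wfin[u Wu ->]|_ [u Wu <-]//].
  by exists u.
have [e Ke] := Kint.
have anti u v : WSup K N u%:E -> WSup K N v%:E -> ~ lt u%:E v%:E.
  move=> /WSup_notbelow Nu Wv uv; apply/Nu/below_WSup => //.
  by exists v%:E.
have subk u k : interior K k -> lt (u - k)%:E u%:E.
  by move=> Kk; apply/ltK_subr_addr/ltK_addr.
split.
- apply/seteqP; split=> // y _; have [Ny|Ny] := pselect (below N y%:E).
    have [_ /Wfin[u Wu ->] /ltK_fin yu] := (below_WSup y pN).2 Ny.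
    by left; left; exists u => //; exists (u - y); rewrite // subKr.
  have [t] := WSup_line Ke pN Ny.
  rewrite le_eqVlt => /predU1P[<-|t0 Wt].
    by rewrite scale0r subr0; left; right.
  right; exists (y - t *: e) => //; exists (t *: e); last by rewrite subrK.
  exact: interior_scale.
- apply/seteqP; split=> // y [[u Wu [k Kk E]] Wy].
  by apply: (anti y u Wy Wu); rewrite -E; exact: subk.
- apply/seteqP; split=> // y [Wy [u Wu [k Kk E]]].
  by apply: (anti u y Wu Wy); rewrite -E; exact: ltK_addr.
- apply/seteqP; split=> // y [[u Wu [k Kk uy]] [v Wv [h Kh vy]]].
  apply: (anti v u Wv Wu); apply: (@ltK_trans _ y%:E).
    by rewrite -vy; exact: ltK_addr.
  by rewrite -uy; exact: subk.
Qed.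

(** Adding an element of [K] cannot bring a point below [N], as [K + int K] lies in [int K].
    Conversely the descent to [WSup K N] is by [t *: e], an element of [K], with [cone0] covering
    [t = 0]. *)
Lemma WSup_addK N y : proper_set N ->
  eaddset (WSup K N) (EFin @` K) y%:E <-> ~ below N y%:E.
Proof.
move=> pN; have [e Ke] := Kint; split=> [[u Wu [_ [k Kk <-]]]|Ny].
  case: u Wu => // u Wu [<-] [v Nv ukv].
  apply: (WSup_notbelow Wu); exists v => //.
  case: v ukv {Nv} => // v /ltK_fin/(interior_addl Kk).
  by rewrite addrC opprD addrCA addNKr => uv; apply/ltK_fin.
have [t t0 Wt] := WSup_line Ke pN Ny.
exists (y - t *: e)%:E => //; exists (t *: e)%:E; last first.
  exact: (congr1 EFin (subrK _ _)).
exists (t *: e) => //; move: t0; rewrite le_eqVlt => /predU1P[<-|t0].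
  by rewrite scale0r; exact: cone0 (interior_subset Ke).
exact: interior_subset (interior_scale t0 Ke).
Qed.

(** * Sums with a weak supremum *)

Lemma ltK_adde_fin y r (v : \bar Y) : lt y%:E (r%:E + v)%E <-> lt (y - r)%:E v.
Proof.
by case: v => [s||] //; rewrite (ltK_subr_addr y s r) addrC.
Qed.

(** For finite [m] a translation reduces this to [below_WSup]; for [m = -oo] both sides hold
    trivially. *)
Lemma ltK_adde_WSup N y (m : \bar Y) : proper_set N -> m <> +oo%E ->
  (forall v, WSup K N v -> ~ lt y%:E (m + v)%E) <->
  (forall v, N v -> ~ lt y%:E (m + v)%E).
Proof.
move=> pN; case: m => [r _||] //; last first.
  by move=> _; split=> _ [v||] _ [].
have b V : (forall v, V v -> ~ lt y%:E (r%:E + v)%E) <-> ~ below V (y - r)%:E.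
  split=> [yV [v Vv] /ltK_adde_fin|yV v Vv /ltK_adde_fin yv]; first exact: yV.
  by apply: yV; exists v.
by rewrite !b (below_WSup _ pN).
Qed.

(* For the converse implication, U is the weak supremum of the set D of the u *)
(* such that y - u is not below V.                                            *)
Lemma uplus_witnessP M V0 y : proper_set M -> proper_set V0 ->
  (exists U, [/\ WSup K M <> [set +oo%E], Pp K U,
     preceqK K (WSup K M) (EFin @` U)
     & uplus K (EFin @` U) (WSup K V0) y%:E]) <->
  (forall m v, M m -> WSup K V0 v -> ~ lt y%:E (m + v)%E).
Proof.
move=> pM pV0; have [e Ke] := Kint; set V := WSup K V0; split.
  move=> [U [_ PU MU /WSup_notbelow yUV]] m v Mm Vv ymv.
  case: m Mm ymv => [r||] Mm ymv; [|by case: pM|by case: v {Vv} ymv].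
  suff [u Uu yu] : exists2 u, U u & lt y%:E (u%:E + v)%E.
    by apply: yUV; exists (u%:E + v)%E => //; exists u%:E; [exists u|exists v].
  case: v Vv ymv => [s||] Vv ymv; last by [].
    have [d Wd] : below (WSup K M) (y - s)%:E.
      apply/below_WSup => //; exists r%:E => //.
      by apply/ltK_subr_addr.
    (* [p] lies strictly between [y - s] and [d]. If [p] is in [U] or [U - int K], a suitable [u] is
       at hand; if [p] is in [U + int K], some [u] in [U] lies under [d], against the set order. *)
    move=> /(@ltK_line _ e)[t t0]; pose p := y - s + t *: e => pd.
    have yp : lt (y - s)%:E p%:E by exact: ltK_addr (interior_scale t0 Ke).
    have [UT _ _ _] := PU; have : setT p by [].
    rewrite -UT => -[[[u Uu [k Kk up]]|Up]|[u Uu [k Kk up]]].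
    - exists u => //; apply/ltK_subr_addr/(ltK_trans yp).
      by rewrite -up; apply/ltK_subr_addr/ltK_addr.
    - by exists p => //; exact/ltK_subr_addr.
    - exfalso; apply: (MU d u%:E Wd); first by exists u.
      by apply: (@ltK_trans _ p%:E _ _ pd); rewrite -up; exact: ltK_addr.
  by have [u Uu] := Pp_nonempty PU; exists u.
move=> yMV; have [m0 Mm0] := pM.2.
have Voo : V <> [set +oo%E].
  by move=> VE; apply: (yMV m0%:E +oo%E) => //; rewrite VE.
have [V1 PV1 VE] := WSup_Pp pV0 Voo.
have [v0 V1v0] := Pp_nonempty PV1.
have Vv0 : V v0%:E by rewrite /V VE; exists v0.
pose D := EFin @` [set u | ~ below V (y - u)%:E].
have MD m : M m%:E -> D m%:E.
  move=> Mm; exists m => // -[v Vv /ltK_adde_fin]; exact: yMV.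
have pD : proper_set D by split; [case|exists m0; exact: MD].
(* A finite point not below [D], hence not below [M] either: it keeps both weak suprema from being
   [{+oo}]. *)
pose p := y - (v0 - e).
have Dp : ~ below D p%:E.
  move=> [_ [d Dd <-]] /ltK_subCl yd; apply: Dd; exists v0%:E => //.
  by apply: ltK_trans yd _; apply/ltK_subr_addr/ltK_addr.
have bMD u : below M u%:E -> below D u%:E.
  move=> [[m||] Mm um]; [|by case: pM|by []].
  by exists m%:E => //; exact: MD.
have Noo (N : set (\bar Y)) : ~ below N p%:E -> WSup K N <> [set +oo%E].
  move=> Np NE; have [_ /(_ p%:E)[]//] : WSup K N +oo%E by rewrite NE.
  by move=> v Nv pv; apply: Np; exists v.
have [U PU UE] := WSup_Pp pD (Noo D Dp).
exists U; split=> //.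
- by apply: Noo => /bMD.
- rewrite -UE => d v [_ dM] Dv vd.
  case: v Dv vd => [v||] Dv vd; [|exact: ltK_pinftyl vd|exact: WSup_Nninfty Dv].
  have [m Mm vm] := dM _ vd.
  by apply: (WSup_notbelow Dv); apply: bMD; exists m.
rewrite -UE; split.
  move=> _ [u Du [v Vv <-]].
  case: u Du => [r||] Du; last by case: v {Vv} => [?||] [].
  2: by rewrite UE in Du; case: Du.
  (* The slack [t] pays for passing from [r] in [WSup K D] to some [d] in [D] above [r - t e]; then
     [y - d] lies under [v], against the definition of [D]. *)
  move=> /ltK_adde_fin/(@ltK_line _ e)[t t0 tv].
  have [_ [d Dd <-] ud] : below D (r - t *: e)%:E.
    apply/(below_WSup _ pD); exists r%:E => //.
    exact/ltK_subr_addr/(ltK_addr _ (interior_scale t0 Ke)).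
  apply: Dd; exists v => //; apply: ltK_trans tv.
  by rewrite ltK_subCl opprD opprB addrA subrKC.
have [u Uu] := Pp_nonempty PU.
move=> [w||] // wy; last first.
  exists (u%:E + v0%:E)%E => //; exists u%:E; last by exists v0%:E.
  by rewrite UE; exists u.
have [|d Dd wd] := (below_WSup (w - v0) pD).2 _.
  have [t t0 twy] := ltK_line e wy.
  (* This point is in [D] because [v0 + t e], lying above the point [v0] of the weak supremum [V],
     is not below [V]. *)
  exists (y - (v0 + t *: e))%:E.
    exists (y - (v0 + t *: e)) => //=; rewrite subKr => -[v Vv tv].
    apply: (WSup_notbelow Vv0); apply/(below_WSup _ pV0); exists v => //.
    by apply: ltK_trans tv; apply/ltK_addr/interior_scale.
  apply/ltK_subr_addr; rewrite addrC opprD addrCA addNKr.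
  by rewrite -ltK_subr_addr opprK.
exists (d + v0%:E)%E.
  by exists d => //; exists v0%:E.
have -> : (d + v0%:E = v0%:E + d)%E.
  by case: d {Dd wd} => // r; exact: (congr1 EFin (addrC _ _)).
exact/ltK_adde_fin.
Qed.

Definition finite_values N : Prop := forall v, N v -> exists a, v = a%:E.

Lemma WSup_finite_values N : proper_set N -> WSup K N <> [set +oo%E] ->
  finite_values (WSup K N) /\ WSup K N !=set0.
Proof.
move=> pN /(WSup_Pp pN)[U PU ->]; split; first by move=> _ [u _ <-]; exists u.
by have [u Uu] := Pp_nonempty PU; exists u%:E; exists u.
Qed.

(** For each fixed [a] in [Q], absorb [a] into [m] and apply [ltK_adde_WSup]. *)
Lemma eaddset_WSup_ltK Q N y (m : \bar Y) : proper_set N -> finite_values Q ->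
  m <> +oo%E ->
  (forall v, eaddset Q (WSup K N) v -> ~ lt y%:E (m + v)%E) <->
  (forall v, eaddset Q N v -> ~ lt y%:E (m + v)%E).
Proof.
move=> pN Qfin moo.
have addA (a : Y) v : (m + (a%:E + v) = m + a%:E + v)%E.
  by case: m v {moo} => [b||] [c||] //; exact: (congr1 EFin (addrA _ _ _)).
have b V : (forall v, eaddset Q V v -> ~ lt y%:E (m + v)%E) <->
    (forall a, Q a%:E -> forall v, V v -> ~ lt y%:E (m + a%:E + v)%E).
  split=> [yV a Qa v Vv|yV _ [q Qq [v Vv <-]]].
    by rewrite -addA; apply: yV; exists a%:E => //; exists v.
  by have [a qa] := Qfin _ Qq; rewrite qa addA; apply: yV; rewrite -?qa.
have maoo a : (m + a%:E)%E <> +oo%E by case: m moo {addA b}.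
rewrite !b; split=> yV a Qa; apply/(ltK_adde_WSup _ pN (maoo a)); exact: yV.
Qed.

(** * From membership in [-int K] to strict inequalities *)

(** Links the form of the assertions to the form produced by epigraphs; at [l = +oo] both sides
    fail. *)
Lemma mint_ltK y c (l : \bar Y) : l <> -oo%E ->
  (EFin @` oppset (interior K)) (l - c%:E + y%:E)%E <-> lt y%:E (c%:E - l)%E.
Proof.
case: l => [l||] // _; last by split=> [[]|].
have b : l - c + y = - (c - l - y) by rewrite !opprD !opprK [- c + l]addrC.
split=> [[_ [h Kh <-]] [hE]|/ltK_fin Kh].
  by apply/ltK_fin; move: hE; rewrite b => /oppr_inj <-.
by exists (l - c + y) => //; exists (c - l - y).
Qed.

Lemma eaddset_mint Q y c (l : \bar Y) : finite_values Q -> l <> -oo%E ->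
  eaddset Q (EFin @` oppset (interior K)) (l - c%:E + y%:E)%E <->
  exists2 q, Q q & lt y%:E (c%:E - l + q)%E.
Proof.
move=> Qfin; case: l => [l||] // _; last first.
  split=> [[q /Qfin[a ->] [_ [k _ <-]]]//|[q /Qfin[a ->]]//].
split=> [[q Qq [_ [k Kk <-]]]|[q Qq]]; have [a qa] := Qfin _ Qq; subst q.
  move=> [E]; exists a%:E => //; apply/ltK_fin; case: Kk => h Kh hk.
  suff -> : c - l + a - y = h by [].
  have -> : h = - (l - c + y - a) by rewrite -[h]opprK hk -E addrAC subrr add0r.
  by rewrite !opprD !opprK [- l + c]addrC addrAC.
move=> /ltK_fin Kh; exists a%:E => //; exists (l - c + y - a)%:E; last first.
  exact: (congr1 EFin (subrKC _ _)).
exists (l - c + y - a) => //; exists (c - l + a - y) => //.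
by rewrite !opprD !opprK [- c + l]addrC addrAC.
Qed.

(** * Epigraphs and extended epigraphs of conjugates *)

Section Conjugates.
Variables (X : tvsType R) (E : X -> \bar Y) (Eproper : proper_map E).

Lemma proper_set_conj (L : clin X Y) :
  proper_set [set ((L x)%:E - E x)%E | x in setT].
Proof.
case: Eproper => Enoo [x0 Ex0]; split.
  by move=> [x _]; have := Enoo x; case: (E x).
case Er : (E x0) (Enoo x0) Ex0 => [r||] // _; rewrite /dom/= Er// => _.
by exists (L x0 - r); exists x0; rewrite // Er.
Qed.

Lemma conj_epiP (L : clin X Y) y :
  conj_epi K E (L, y) <-> forall x, ~ lt y%:E ((L x)%:E - E x)%E.
Proof.
rewrite /conj_epi/= WSup_addK; last exact: proper_set_conj.
split=> [yN x yx|yN [_ [x _ <-]]]; last exact: yN.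
by apply: yN; exists ((L x)%:E - E x)%E => //; exists x.
Qed.

(** The added pair has operator 0, so [L] is unchanged and only the choice of [U] remains, which
    [uplus_witnessP] eliminates. *)
Lemma Psi_boxplusP (V0 : set (\bar Y)) (L : clin X Y) y : proper_set V0 ->
  Psi (boxplus K (conj_Epi K E) [set (0, WSup K V0)]) (L, y) <->
  forall x v, WSup K V0 v -> ~ lt y%:E ((L x)%:E - E x + v)%E.
Proof.
move=> pV0; transitivity (exists U, [/\ conj_map K E L <> [set +oo%E], Pp K U,
   preceqK K (conj_map K E L) (EFin @` U)
   & uplus K (EFin @` U) (WSup K V0) y%:E]).
  split=> [[_ [[L' _] [/= L'dom [U PU <-] L'U] [_ -> <-]] [/= -> Uy]]|].
    by exists U; rewrite addr0.
  move=> [U [Ldom PU LU Uy]].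
  exists (L, uplus K (EFin @` U) (WSup K V0)) => //.
  exists (L, EFin @` U); first by split=> //; exists U.
  by exists (0, WSup K V0); rewrite // addr0.
rewrite (uplus_witnessP _ (proper_set_conj L) pV0).
split=> [yN x v|yN _ v [x _ <-]]; last exact: yN.
by apply: yN; exists x.
Qed.

End Conjugates.

End ConvexCone.

(** * Indicator maps and composites *)

Lemma adde_zero (V : zmodType) (u : \bar V) : (u + 0%:E = u)%E.
Proof. by case: u => // r; exact: (congr1 EFin (addr0 _)). Qed.

Lemma conj_indic_value (R : realType) (Z Y : tvsType R) (D : set Z)
    (T : clin Z Y) (z : Z) :
  ((T z)%:E - indic_map Y D z)%E = if z \in D then (T z)%:E%E else -oo%E.
Proof.
rewrite /indic_map; case: ifP => // _.
exact: (congr1 EFin (subr0 _)).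
Qed.

Lemma clinN (R : realType) (Z Y : tvsType R) (T : clin Z Y) (z : Z) :
  T (- z) = - T z.
Proof.
have [Tlin _] : linear T /\ continuous T by apply/asboolP/clinP.
have T0 : T 0 = 0.
  by have := Tlin (-1) 0 0; rewrite scaler0 addr0 scaleN1r addNr.
by have := Tlin (-1) z 0; rewrite !scaleN1r T0 !addr0.
Qed.

(** Outside [C] the right-hand sum is [-oo], which is above no finite point. *)
Lemma ltK_indic (R : realType) (T : Type) (Y : tvsType R) (K : set Y)
    (C : set T) (l : T -> \bar Y) (y c : Y) (v : \bar Y) (x : T) :
  noninfty l ->
  ltK K y%:E (c%:E - (l x + indic_map Y C x) + v)%E <->
  C x /\ ltK K y%:E (c%:E - l x + v)%E.
Proof.
move=> lnoo; rewrite /indic_map; case: ifPn => [/set_mem Cx|/negP Cx].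
  by rewrite adde_zero; split=> [|[]].
split=> [|[/mem_set]//].
by have := lnoo x; case: (l x) v => [r||] [s||].
Qed.

Lemma noninfty_adde (T : Type) (V : zmodType) (f g : T -> \bar V) :
  noninfty f -> noninfty g -> noninfty (fun x => f x + g x)%E.
Proof.
by move=> nf ng x; move: (nf x) (ng x); case: (f x) => [?||]; case: (g x).
Qed.

Lemma noninfty_ecomp (T V Y : Type) (f : V -> \bar Y) (E : T -> \bar V) :
  noninfty f -> noninfty (ecomp f E).
Proof. by move=> nf x; rewrite /ecomp; case: (E x). Qed.

Lemma noninfty_indic (T : Type) (Y : zmodType) (D : set T) :
  noninfty (@indic_map T Y D).
Proof. by move=> x; rewrite /indic_map; case: ifP. Qed.

(** * The two characterizations *)

Theorem corollary5p3 (R : realType) (X Y Z W : tvsType R)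
    (hX : hausdorff_space X) (hY : hausdorff_space Y)
    (hZ : hausdorff_space Z) (hW : hausdorff_space W)
    (K : set Y) (Kproper : K <> setT) (Kclosed : closed K)
    (Kcone : convex_cone K) (Kint : interior K !=set0)
    (P : set W) (P0 : P !=set0) (Pcone : convex_cone P)
    (S : set Z) (S0 : S !=set0) (Scone : convex_cone S)
    (F : X -> \bar Y) (kappa : W -> \bar Y)
    (H : X -> \bar W) (G : X -> \bar Z)
    (Fproper : proper_map F) (kproper : proper_map kappa)
    (Hproper : proper_map H) (Gproper : proper_map G)
    (C : set X) (C0 : C !=set0)
    (qual : feasible C G S `&` dom F `&` H @^-1` (EFin @` dom kappa) !=set0) :
  let A := feasible C G S in
  let lagr (T1 : clin W Y) (T2 : clin Z Y) (x : X) : \bar Y :=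
    (F x + lcomp T1 H x + lcomp T2 G x)%E in
  let epiA : set (clin X Y * Y) :=
    conj_epi K (fun x => F x + ecomp kappa H x + indic_map Y A x)%E in
  let EpiC (T1 : clin W Y) (T2 : clin Z Y) : set (clin X Y * set (\bar Y)) :=
    conj_Epi K (fun x => lagr T1 T2 x + indic_map Y C x)%E in
  let M1 : set (clin X Y * Y) :=
    \bigcup_(T1 in conj_dom K kappa) \bigcup_(T2 in Lwplus K S)
      Psi (boxplus K (EpiC T1 T2)
        [set (0, uplus K (conj_map K kappa T1)
                         (conj_map K (indic_map Y (oppset S)) T2))]) in
  let M1plus : set (clin X Y * Y) :=
    \bigcup_(T1 in conj_dom K kappa `&` Lplus K P) \bigcup_(T2 in Lplus K S)
      Psi (boxplus K (EpiC T1 T2) [set (0, conj_map K kappa T1)]) in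
  let mintK : set (\bar Y) := EFin @` oppset (interior K) in
  let alpha (L : clin X Y) (y : Y) : Prop :=
    forall x, C x -> (EFin @` oppset S) (G x) ->
      ~ mintK (F x + ecomp kappa H x - (L x)%:E + y%:E)%E in
  let beta (L : clin X Y) (y : Y) : Prop :=
    exists (T1 : clin W Y) (T2 : clin Z Y),
      [/\ conj_dom K kappa T1, Lwplus K S T2 & forall x, C x ->
        ~ eaddset (eaddset (conj_map K kappa T1) (EFin @` (T2 @` oppset S)))
                  mintK (lagr T1 T2 x - (L x)%:E + y%:E)%E] in
  let gamma (L : clin X Y) (y : Y) : Prop :=
    exists (T1 : clin W Y) (T2 : clin Z Y),
      [/\ (conj_dom K kappa `&` Lplus K P) T1, Lplus K S T2 & forall x, C x ->
        ~ eaddset (conj_map K kappa T1) mintK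
                  (lagr T1 T2 x - (L x)%:E + y%:E)%E] in
  (epiA = M1 <-> forall (L : clin X Y) (y : Y), alpha L y <-> beta L y) /\
  (epiA = M1plus <-> forall (L : clin X Y) (y : Y), alpha L y <-> gamma L y).
Proof.
move=> A lagr epiA EpiC M1 M1plus mintK alpha beta gamma.
(* The qualification point [x0] makes every mapping conjugated over [X] below proper. *)
have [x0 [[[Cx0 [gx0 Sgx0 Gx0]] Fx0] [hx0 khx0 Hx0]]] := qual.
have Fnoo := Fproper.1; have knoo := kproper.1.
have lnoo T1 T2 : noninfty (lagr T1 T2).
  by do 2![apply: noninfty_adde; last exact: noninfty_ecomp].
have Eproper T1 T2 : proper_map (fun x => lagr T1 T2 x + indic_map Y C x)%E.
  split; first by apply: noninfty_adde => //; exact: noninfty_indic.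
  exists x0; rewrite /dom/= /lagr /lcomp /ecomp -Gx0 -Hx0 /indic_map mem_set//.
  by move: Fx0; rewrite /dom/=; case: (F x0).
have EAproper : proper_map (fun x => F x + ecomp kappa H x + indic_map Y A x)%E.
  split.
    apply: noninfty_adde; last exact: noninfty_indic.
    by apply: noninfty_adde => //; exact: noninfty_ecomp.
  exists x0; rewrite /dom/= /ecomp -Hx0 /indic_map mem_set; last first.
    by split=> //; exists gx0.
  by move: Fx0 khx0; rewrite /dom/=; case: (F x0) => // ?; case: (kappa hx0).
have epiAP L y : epiA (L, y) <-> alpha L y.
  have fnoo : noninfty (fun x => F x + ecomp kappa H x)%E.
    by apply: noninfty_adde => //; exact: noninfty_ecomp.
  rewrite /epiA conj_epiP//; split=> [yN x Cx GSx|yN x].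
    (* Adding 0 gives the goal the shape of [ltK_indic]. *)
    move=> /mint_ltK yx; apply: (yN x); rewrite -[X in ltK _ _ X]adde_zero.
    apply: (ltK_indic _ _ _ _ _ _ fnoo).2; rewrite adde_zero; split=> //.
    by apply: yx => //; exact: fnoo.
  rewrite -[X in ltK _ _ X]adde_zero => /(ltK_indic _ _ _ _ _ _ fnoo)[[Cx GSx]].
  rewrite adde_zero => yx; apply: (yN x Cx GSx); apply/mint_ltK => //.
have pk (T1 : clin W Y) : proper_set [set ((T1 w)%:E - kappa w)%E | w in setT].
  exact: proper_set_conj.
have mfin (L : clin X Y) T1 T2 x : ((L x)%:E - lagr T1 T2 x)%E <> +oo%E.
  by have := lnoo T1 T2 x; case: (lagr T1 T2 x).
have PsiP T1 T2 V0 L y : proper_set V0 ->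
    Psi (boxplus K (EpiC T1 T2) [set (0, WSup K V0)]) (L, y) <->
    forall x, C x -> forall v, WSup K V0 v ->
      ~ ltK K y%:E ((L x)%:E - lagr T1 T2 x + v)%E.
  move=> pV0; rewrite Psi_boxplusP//; split=> [yN x Cx v Vv yx|yN x v Vv].
    by apply: (yN x v) => //; apply: (ltK_indic _ _ _ _ _ _ (lnoo T1 T2)).2.
  by move=> /(ltK_indic _ _ _ _ _ _ (lnoo T1 T2))[Cx]; exact: yN.
have M1plusP L y : M1plus (L, y) <-> gamma L y.
  have side T1 T2 : conj_dom K kappa T1 ->
      Psi (boxplus K (EpiC T1 T2) [set (0, conj_map K kappa T1)]) (L, y) <->
      forall x, C x -> ~ eaddset (conj_map K kappa T1) mintK
        (lagr T1 T2 x - (L x)%:E + y%:E)%E.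
    move=> dT1; have [fin _] := WSup_finite_values Kcone Kint (pk T1) dT1.
    rewrite PsiP//; split=> yN x Cx.
      by move=> /(eaddset_mint _ _ _ fin (@lnoo T1 T2 x))[v]; exact: yN.
    move=> v Vv yx; apply: (yN x Cx).
    by apply/(eaddset_mint _ _ _ fin (@lnoo T1 T2 x)); exists v.
  split=> [[T1 [dT1 PT1] [T2 ST2 yN]]|[T1 [T2 [[dT1 PT1] ST2 yN]]]].
    by exists T1, T2; split=> //; exact: (side T1 T2 dT1).1.
  by exists T1 => //; exists T2 => //; apply/side.
have M1P L y : M1 (L, y) <-> beta L y.
  have side T1 T2 : conj_dom K kappa T1 -> Lwplus K S T2 ->
      Psi (boxplus K (EpiC T1 T2)
        [set (0, uplus K (conj_map K kappa T1)
                         (conj_map K (indic_map Y (oppset S)) T2))]) (L, y) <->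
      forall x, C x ->
        ~ eaddset (eaddset (conj_map K kappa T1) (EFin @` (T2 @` oppset S)))
                  mintK (lagr T1 T2 x - (L x)%:E + y%:E)%E.
    move=> dT1 wT2.
    have [finA [a Aa]] := WSup_finite_values Kcone Kint (pk T1) dT1.
    have pN : proper_set
        [set ((T2 z)%:E - indic_map Y (oppset S) z)%E | z in setT].
      apply: proper_set_conj; split; first exact: noninfty_indic.
      have [s Ss] := S0; exists (- s).
      by rewrite /dom/= /indic_map mem_set//; exists s.
    (* 0 is not below the generating set: its finite values are [- T2 s] with [s] in [S], and
       [0 <_K - T2 s] would put [T2 s] in [-int K], which [Lwplus] forbids. *)
    have N0 : conj_map K (indic_map Y (oppset S)) T2 <> [set +oo%E].
      move=> NE; have : conj_map K (indic_map Y (oppset S)) T2 +oo%E.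
        by rewrite NE.
      move=> [_ /(_ 0%:E)[]// _ [z _ <-]].
      rewrite conj_indic_value; case: ifP => // /set_mem[s Ss <-].
      rewrite clinN => /ltK_fin; rewrite subr0 => Ks.
      have : (T2 @` S `&` oppset (interior K)) (T2 s).
        by split; [exists s|exists (- T2 s); rewrite // opprK].
      by rewrite wT2.
    have [finB [b Bb]] := WSup_finite_values Kcone Kint pN N0.
    have pV0 : proper_set (eaddset (conj_map K kappa T1)
                         (conj_map K (indic_map Y (oppset S)) T2)).
      split.
        by move=> [u /finA[u' ->]] [v /finB[v' ->]].
      have [[a' aE] [b' bE]] := (finA _ Aa, finB _ Bb).
      by exists (a' + b'); exists a => //; exists b; rewrite // aE bE.
    have finQ : finite_values
        (eaddset (conj_map K kappa T1) (EFin @` (T2 @` oppset S))).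
      by move=> _ [u /finA[u' ->] [_ [t _ <-]] <-]; exists (u' + t).
    (* Both directions remove two weak suprema, that of [uplus] and that of the indicator's
       conjugate. What remains is [kappa^*(T1)] plus the values [T2 z - I_{-S}(z)], whose finite
       ones form [T2(-S)]. *)
    rewrite PsiP//; split=> yN x Cx.
      move=> /(eaddset_mint _ _ _ finQ (@lnoo T1 T2 x))
        [_ [u Au [_ [_ [_ [s Ss <-] <-] <-] <-]]].
      have := yN x Cx; rewrite ltK_adde_WSup// eaddset_WSup_ltK//; apply.
      exists u => //; exists (T2 (- s))%:E => //.
      by exists (- s); rewrite // conj_indic_value mem_set//; exists s.
    rewrite ltK_adde_WSup// eaddset_WSup_ltK// => _ [u Au [_ [s _ <-] <-]].
    rewrite conj_indic_value; case: ifPn => [/set_mem Ss yx|_]; last first.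
      by have [r ->] := finA _ Au; case: ((L x)%:E - _)%E => [?||] [].
    apply: (yN x Cx); apply/(eaddset_mint _ _ _ finQ (@lnoo T1 T2 x)).
    exists (u + (T2 s)%:E)%E => //.
    by exists u => //; exists (T2 s)%:E => //; exists (T2 s) => //; exists s.
  split=> [[T1 dT1 [T2 ST2 yN]]|[T1 [T2 [dT1 ST2 yN]]]].
    by exists T1, T2; split=> //; exact: (side T1 T2 dT1 ST2).1.
  by exists T1 => //; exists T2 => //; apply/side.
have set_eqP (M N : set (clin X Y * Y)) (a b : clin X Y -> Y -> Prop) :
    (forall L y, M (L, y) <-> a L y) -> (forall L y, N (L, y) <-> b L y) ->
    M = N <-> forall L y, a L y <-> b L y.
  move=> Ma Nb; split=> [MN L y|ab]; first by rewrite -Ma -Nb MN.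
  by apply/seteqP; split=> -[L y]; rewrite Ma Nb ab.
by split; apply: set_eqP.
Qed.
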